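(* Suppose that the smooth strong solution curves $(r_D^S,\pm\theta_D^S)$, $D>0$ (defined in the context), are global minimizers of $T$ over $\mathcal{A}_0$, i.e. each of them minimizes $T$ among all curves of $\mathcal{A}_0$ with the same endpoints. Let $\epsilon\in(0,1)$ and $\theta_f\in(0,\pi]$. If $\theta_f/2<\theta_c^\epsilon$, then there exists $D\ge D(\epsilon)>0$ such that $(r_D^S(s),\theta_D^S(s))\in\mathcal{A}_\epsilon$ and this curve minimizes $T$ over the curves in $\mathcal{A}_\epsilon$ terminating at the point with polar coordinates $(1,\theta_f)$.
   Context: Admissible curves: for a terminal point $B$, $\mathcal{A}_0=\{\alpha\in AC([0,1];\mathbb{R}^2):\alpha(0)=(1,0),\ \alpha(1)=B,\ |\alpha(s)|\le1\ \forall s\}$ ($AC$ = absolutely continuous). For $\epsilon\in(0,1)$, $\mathcal{A}_\epsilon=\{\alpha\in\mathcal{A}_0: |\alpha(s)|\ge\epsilon\ \forall s\in[0,1]\}$. A pair $(r,\theta)$ stands for the curve $\alpha(s)=(r(s)\cos\theta(s),r(s)\sin\theta(s))$. The time of flight (inverse-square gravitational field centered at the origin) is $$T[\alpha]=\int_0^1\frac{|\alpha'(s)|}{\sqrt{|\alpha(s)|^{-1}-1}}\,ds,\qquad\text{i.e. in polar form } T[r,\theta]=\int_0^1\sqrt{\frac{r'(s)^2+r(s)^2\theta'(s)^2}{r(s)^{-1}-1}}\,ds.$$ Strong solution curves: for $D>0$ let $r_c(D)\in(0,1)$ be the unique root in $(0,1)$ of $r^3+2Dr-2D=0$. Define $$r_D^S(s)=\begin{cases}2(r_c(D)-1)s+1,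 & 0\le s\le \tfrac12,\\ 2(1-r_c(D))(s-1)+1, & \tfrac12<s\le 1,\end{cases}$$ and, with $f_D(u)=\sqrt{\dfrac{2(1-u)D}{u^5-2u^2D(1-u)}}$ for $u\in(r_c(D),1]$, $$\theta_D^S(s)=\begin{cases}\displaystyle\int_{r_D^S(s)}^1 f_D(u)\,du, & 0\le s\le\tfrac12,\\[2mm] \displaystyle\theta_D^S(1/2)+\int_{r_c(D)}^{r_D^S(s)}f_D(u)\,du, & \tfrac12\le s\le1.\end{cases}$$ Critical parameter and angle: $D(\epsilon)>0$ is the unique value of $D$ for which the strong solution curve touches the circle of radius $\epsilon$ tangentially, i.e. $r_c(D(\epsilon))=\epsilon$, and $\theta_c^\epsilon=\theta_{D(\epsilon)}^S(1/2)$ is the angle of the tangency point. *)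

(* Defs.v *)
From HB Require Import structures.
From mathcomp Require Import all_boot all_order all_algebra.
From mathcomp Require Import all_classical all_reals all_analysis.
From mathcomp Require Import ring lra.

Set Implicit Arguments.
Unset Strict Implicit.
Unset Printing Implicit Defensive.

Import Order.TTheory GRing.Theory Num.Theory.
Import numFieldNormedType.Exports.

Local Open Scope classical_set_scope.
Local Open Scope ring_scope.

(* The library norm on R * R is the sup norm, hence this definition. *)
Definition enorm (R : realType) (p : R * R) : R :=
  Num.sqrt (p.1 ^+ 2 + p.2 ^+ 2).

Definition abs_continuous (R : realType) (a b : R) (alpha : R -> R * R) : Prop :=
  forall e : R, 0 < e -> exists2 d : R, 0 < d &
    forall (n : nat) (x y : 'I_n -> R),
      (forall i, a <= x i /\ x i <= y i /\ y i <= b) ->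
      trivIset [set: 'I_n] (fun i => `]x i, y i[%classic) ->
      \sum_(i < n) (y i - x i) < d ->
      \sum_(i < n) enorm (alpha (y i) - alpha (x i)) < e.

(* Curves are total functions of which only the values on [0, 1] matter. *)
Definition A0 (R : realType) (B : R * R) : set (R -> R * R) :=
  [set alpha | [/\ abs_continuous 0 1 alpha,
                   alpha 0 = (1, 0),
                   alpha 1 = B &
                   forall s, 0 <= s <= 1 -> enorm (alpha s) <= 1]].

Definition Aeps (R : realType) (eps : R) (B : R * R) : set (R -> R * R) :=
  [set alpha | A0 B alpha /\
               forall s, 0 <= s <= 1 -> eps <= enorm (alpha s)].

Definition velocity (R : realType) (alpha : R -> R * R) (s : R) : R * R :=
  (derive1 (fun t => (alpha t).1) s, derive1 (fun t => (alpha t).2) s).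

(* The integrand is computed in [0, +oo] with the library conventions
   0^-1 = +oo, +oo^-1 = 0 and 0 * +oo = 0: it is +oo at a point of the unit
   circle crossed with nonzero velocity, and 0 at the origin.  With the total
   inverse of R, motion along the unit circle would take no time. *)
Definition time_of_flight (R : realType) (alpha : R -> R * R) : \bar R :=
  (\int[lebesgue_measure]_(s in `[0%R, 1%R])
     ((enorm (velocity alpha s))%:E
        / sqrte (((enorm (alpha s))%:E)^-1 - 1)))%E.

Definition minimizes (R : realType) (alpha : R -> R * R)
    (A : set (R -> R * R)) : Prop :=
  A alpha /\
  forall beta, A beta -> (time_of_flight alpha <= time_of_flight beta)%E.

Definition polar (R : realType) (r theta : R -> R) : R -> R * R :=
  fun s => (r s * cos (theta s), r s * sin (theta s)).

(* The root exists and is unique for 0 < D; see r_cP and r_c_unique. *)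
Definition r_c (R : realType) (D : R) : R :=
  xget 0 [set r | 0 < r < 1 /\ r ^+ 3 + 2 * D * r - 2 * D = 0].

Definition rS (R : realType) (D s : R) : R :=
  if s <= 2^-1 then 2 * (r_c D - 1) * s + 1
  else 2 * (1 - r_c D) * (s - 1) + 1.

Definition fS (R : realType) (D u : R) : R :=
  Num.sqrt (2 * (1 - u) * D / (u ^+ 5 - 2 * u ^+ 2 * D * (1 - u))).

Definition thetaS_in (R : realType) (D s : R) : R :=
  \int[lebesgue_measure]_(u in `[rS D s, 1]) fS D u.

Definition thetaS (R : realType) (D s : R) : R :=
  if s <= 2^-1 then thetaS_in D s
  else thetaS_in D 2^-1 + \int[lebesgue_measure]_(u in `[r_c D, rS D s]) fS D u.

(* Well defined for 0 < eps < 1; see DepsP and Deps_unique. *)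
Definition Deps (R : realType) (eps : R) : R :=
  xget 0 [set D | 0 < D /\ r_c D = eps].

Definition theta_c (R : realType) (eps : R) : R := thetaS (Deps eps) 2^-1.

Lemma r_cP (R : realType) (D : R) : 0 < D ->
  0 < r_c D < 1 /\ r_c D ^+ 3 + 2 * D * r_c D - 2 * D = 0.
Proof.
move=> D0; apply: (@xgetPex _ 0
  [set r : R | 0 < r < 1 /\ r ^+ 3 + 2 * D * r - 2 * D = 0]).
pose p : {poly R} := 'X^3 + (2 * D) *: 'X - (2 * D)%:P.
have pE x : p.[x] = x ^+ 3 + 2 * D * x - 2 * D by rewrite /p !hornerE.
have [||x /andP[x0 x1] /rootP] := @poly_ivt R p 0 1; first exact: ler01.
  by rewrite !pE; apply/andP; split; [nra | nra].
rewrite pE => px; exists x; split=> //; rewrite !lt_neqAle x0 x1 !andbT.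
apply/andP; split; apply/eqP => xE; move: px; rewrite ?xE -?xE; nra.
Qed.

Lemma r_c_unique (R : realType) (D r : R) : 0 < D -> 0 < r < 1 ->
  r ^+ 3 + 2 * D * r - 2 * D = 0 -> r = r_c D.
Proof.
move=> D0 /andP[r0 r1] hr; have [/andP[c0 c1] hc] := r_cP D0.
move: (r_c D) c0 c1 hc => c c0 c1 hc.
have : (r - c) * (r ^+ 2 + r * c + c ^+ 2 + 2 * D) = 0.
  have -> : (r - c) * (r ^+ 2 + r * c + c ^+ 2 + 2 * D) =
    (r ^+ 3 + 2 * D * r - 2 * D) - (c ^+ 3 + 2 * D * c - 2 * D) by ring.
  by rewrite hr hc subrr.
move/eqP; rewrite mulf_eq0 => /orP[/eqP|/eqP h]; first by move/subr0_eq.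
by exfalso; nra.
Qed.

Lemma DepsP (R : realType) (eps : R) : 0 < eps < 1 ->
  0 < Deps eps /\ r_c (Deps eps) = eps.
Proof.
move=> /andP[e0 e1]; apply: (@xgetPex _ 0 [set D : R | 0 < D /\ r_c D = eps]).
have e1' : 0 < 1 - eps by rewrite subr_gt0.
have D0 : 0 < eps ^+ 3 / (2 * (1 - eps)).
  by rewrite divr_gt0 ?exprn_gt0 ?mulr_gt0.
exists (eps ^+ 3 / (2 * (1 - eps))); split=> //.
apply/esym/r_c_unique; rewrite ?e0//; field.
by rewrite lt0r_neq0.
Qed.

Lemma Deps_unique (R : realType) (eps D : R) : 0 < eps < 1 -> 0 < D ->
  r_c D = eps -> D = Deps eps.
Proof.
move=> e01 D0 hD; have [E0 hE] := DepsP e01; case/andP: e01 => e0 e1.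
have [_] := r_cP D0; have [_] := r_cP E0; rewrite hD hE => h1 h2.
have e1' : 1 - eps != 0 by rewrite subr_eq0 eq_sym lt_eqF.
apply: (mulfI e1'); lra.
Qed.

(* Main.v *)
Require Import Defs.
From HB Require Import structures.
From mathcomp Require Import all_boot all_order all_algebra.
From mathcomp Require Import all_classical all_reals all_analysis.
From mathcomp Require Import measurable_realfun ring lra.
Set Implicit Arguments.
Unset Strict Implicit.
Unset Printing Implicit Defensive.
Import Order.TTheory GRing.Theory Num.Theory.
Import numFieldNormedType.Exports.
Local Open Scope classical_set_scope.
Local Open Scope ring_scope.

(** Minimality over the curves that avoid the disc of radius eps is inherited
    from minimality over all admissible curves, so it suffices to find a strong
    solution curve that ends at the angle theta_f and stays outside that disc.
    The curve with parameter D has smallest radius [r_c D], and its final angle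
    is twice the angle swept while the radius falls from 1 to [r_c D].  The
    point is therefore to solve, for the turning radius c in [eps, 1), the
    equation: swept angle = theta_f / 2.

    This is done with the intermediate value theorem.  The swept angle is
    theta_c at c = eps, above theta_f / 2 by hypothesis, and it tends to 0 as c
    tends to 1, so only its continuity in c is at stake.  That is not visible
    on the defining integral: both the integrand and its domain [c, 1] depend
    on c, and the integrand blows up like the inverse square root of u - c at
    the moving endpoint.  The substitution u = c + (1 - c) s^2 cures all of
    this at once.  The domain becomes [0, 1], and since 2 D (1 - c) = c^3 the
    factor s of du cancels the singularity and leaves [angle_density c s]
    ([half_apertureE]), which is continuous in c and in s and also makes sense
    for c equal to 1 or slightly above.  Dominated convergence with a constant bound
    then gives continuity up to and including c = 1, where the integrand
    vanishes ([half_aperture_continuous], [half_aperture1]).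

    The substitution theorem for continuous integrands does not apply at the
    singular endpoint; [integration_by_substitution_left_singular] extends it
    to nonnegative integrands on half-open intervals. *)

(** * Substitution with a singular left endpoint *)

Lemma continuous_oc_measurable (R : realType) (G : R -> R) (a b : R) :
  {in `]a, b], continuous G} -> measurable_fun `]a, b] G.
Proof.
move=> cG; apply: subspace_continuous_measurable_fun => //.
by apply: continuous_in_subspaceT => u; rewrite inE/= => /cG.
Qed.

(** For nonnegative integrands the improper integral is the Lebesgue integral,
    by monotone convergence along an exhaustion of the half-open interval. *)
Lemma cvg_integral_left_endpoint (R : realType) (G : R -> R) (a b : R)
    (x : nat -> R) :
  {in `]a, b], continuous G} -> {in `]a, b], forall u, 0 <= G u} ->
  nonincreasing_seq x -> (forall n, a < x n) -> x n @[n --> \oo] --> a ->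
  (\int[lebesgue_measure]_(u in `[x n, b]) (G u)%:E @[n --> \oo] -->
   \int[lebesgue_measure]_(u in `]a, b]) (G u)%:E)%E.
Proof.
move=> cG G0 xdec ax xa.
have sub n : `[x n, b] `<=` `]a, b].
  by move=> u/=; rewrite !in_itv/= => /andP[xu ->]; rewrite (lt_le_trans (ax n)).
have mG := continuous_oc_measurable cG.
have -> : `]a, b]%classic = \bigcup_n `[x n, b]%classic.
  apply/seteqP; split => u; last by case=> n _; exact: sub.
  rewrite /= in_itv/= => /andP[au ub].
  have [n _ xn] : \forall n \near \oo, x n < u by exact: (cvgr_lt a).
  by exists n => //=; rewrite in_itv/= ub ltW// xn/=.
apply: ge0_nondecreasing_set_cvg_integral => //.
- move=> m n mn; apply/subsetPset => u/=; rewrite !in_itv/= => /andP[xu ->].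
  by rewrite (le_trans _ xu)// xdec.
- by move=> n; apply/measurable_EFinP; apply: measurable_funS (sub n) mG.
- by move=> n u /sub uab; rewrite lee_fin G0.
Qed.

(** [G] may blow up at [F a], and both integrals may be infinite: the identity
    holds on the intervals that stay away from [a], where [G] is continuous,
    and both sides are the limits of these truncated integrals. *)
Lemma integration_by_substitution_left_singular (R : realType)
    (F G : R -> R) (a b : R) : a < b ->
  {in `[a, b], forall s, derivable F s 1} ->
  {in `[a, b], continuous F^`()%classic} ->
  {in `]a, b], forall s, 0 < F^`()%classic s} ->
  {in `]F a, F b], continuous G} ->
  {in `]F a, F b], forall u, 0 <= G u} ->
  (\int[lebesgue_measure]_(u in `]F a, F b]) (G u)%:E =
   \int[lebesgue_measure]_(s in `]a, b]) ((G (F s) * F^`()%classic s)%:E))%E.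
Proof.
move=> ab dF cF' F'0 cG G0.
have cF : {in `[a, b], continuous F}.
  by move=> s /dF; rewrite derivable1_diffP => /differentiable_continuous.
have incrF : {in `[a, b] &, {homo F : s t / s < t}}.
  apply: gtr0_derive1_lt_cc.
  - by move=> s sab; apply: dF; exact: subset_itv_oo_cc.
  - by move=> s sab; apply: F'0; exact: subset_itv_oo_oc.
  - by apply: continuous_in_subspaceT => s; rewrite inE/= => /cF.
have aab : a \in `[a, b] by rewrite in_itv/= lexx ltW.
have bab : b \in `[a, b] by rewrite in_itv/= lexx ltW.
have Fab s : s \in `]a, b] -> F s \in `]F a, F b].
  rewrite in_itv/= => /andP[as_ sb].
  have sab : s \in `[a, b] by rewrite in_itv/= sb ltW.
  rewrite in_itv/= incrF//=.
  move: sb; rewrite le_eqVlt => /predU1P[->//|sb].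
  by apply/ltW/incrF.
(* The truncation points decrease to a; the first one is b. *)
pose x n : R := a + (b - a) * harmonic n.
have ba0 : 0 < b - a by rewrite subr_gt0.
have xdec : nonincreasing_seq x.
  move=> m n mn; rewrite lerD2l ler_wpM2l ?(ltW ba0)//.
  by rewrite /harmonic/= lef_pV2 ?posrE// ler_nat ltnS.
have ax n : a < x n by rewrite ltrDl mulr_gt0// harmonic_gt0.
have xb n : x n <= b.
  rewrite -lerBrDl -[leRHS]mulr1 ler_pM2l// /harmonic/= invf_le1//.
  by rewrite ler1n.
have xoc n : x n \in `]a, b] by rewrite in_itv/= ax xb.
have xa : x n @[n --> \oo] --> a.
  rewrite -[X in _ --> X]addr0 -[X in _ + X](mulr0 (b - a)).
  by apply: cvgD; [exact: cvg_cst | apply: cvgMr; exact: cvg_harmonic].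
have Fxa : F (x n) @[n --> \oo] --> F a.
  by apply: (cvg_comp _ _ xa); exact: cF.
have oc_cc : {subset `]a, b] <= `[a, b]} by exact: subset_itv_oc_cc.
have cc n : {subset `[x n, b] <= `]a, b]}.
  move=> s; rewrite !in_itv/= => /andP[xs ->].
  by rewrite (lt_le_trans (ax n) xs).
have lim_u : (\int[lebesgue_measure]_(u in `[F (x n), F b]) (G u)%:E
    @[n --> \oo] --> \int[lebesgue_measure]_(u in `]F a, F b]) (G u)%:E)%E.
  apply: (cvg_integral_left_endpoint (x := F \o x)) => //.
  - move=> m n mn; have := xdec _ _ mn; rewrite le_eqVlt => /predU1P[/=->//|xx].
    by apply/ltW/incrF; rewrite ?oc_cc.
  - by move=> n; have := Fab _ (xoc n); rewrite in_itv/= => /andP[].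
have lim_s : (\int[lebesgue_measure]_(s in `[x n, b]) (G (F s) * F^`()%classic s)%:E
    @[n --> \oo] -->
    \int[lebesgue_measure]_(s in `]a, b]) (G (F s) * F^`()%classic s)%:E)%E.
  apply: (@cvg_integral_left_endpoint _ (fun s => G (F s) * F^`()%classic s)) => //.
  - move=> s sab; apply: (@cvgM _ _ (nbhs s)); last by apply: cF'; exact: oc_cc.
    apply: continuous_comp; first by apply: cF; exact: oc_cc.
    by apply: cG; exact: Fab.
  - by move=> s sab; rewrite mulr_ge0// ?G0 ?Fab// ltW ?F'0.
rewrite -(cvg_lim (@ereal_hausdorff R) lim_u) -(cvg_lim (@ereal_hausdorff R) lim_s).
congr (lim (_ @ \oo)).
apply/funext => n.
have := xb n; rewrite le_eqVlt => /predU1P[->|xnb].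
  by rewrite !set_itv1 !integral_set1.
rewrite integration_by_substitution_increasing//.
- by move=> s t /cc/oc_cc sab /cc/oc_cc tab; exact: incrF.
- by move=> s sxb; apply/cF'/oc_cc/(cc n)/subset_itv_oo_cc.
- apply/cvg_ex; exists (F^`()%classic (x n)).
  by apply: cvg_at_right_filter; apply/cF'/oc_cc.
- by apply/cvg_ex; exists (F^`()%classic b); apply: cvg_at_left_filter; exact: cF'.
- split.
  + by move=> s sxb; apply/dF/oc_cc/(cc n)/subset_itv_oo_cc.
  + by apply: cvg_at_right_filter; apply/cF/oc_cc.
  + by apply: cvg_at_left_filter; exact: cF.
- apply: continuous_in_subspaceT => u; rewrite inE/= in_itv/= => /andP[xu ub].
  apply: cG; rewrite in_itv/= ub andbT; apply: lt_le_trans xu.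
  by have := Fab _ (xoc n); rewrite in_itv/= => /andP[].
Qed.

(** * The swept angle as a function of the turning radius *)

(** The quadratic dependence on s absorbs the inverse square root singularity
    of [fS D] at the turning radius c. *)
Definition chord_radius (R : realType) (c s : R) : R := c + (1 - c) * s ^+ 2.

(** With u = [chord_radius c s] and 2 D (1 - c) = c^3, the polynomial
    (1 - c) u^3 - c^3 (1 - u), which vanishes at the turning radius, equals
    (u - c) times this cofactor. *)
Definition chord_cofactor (R : realType) (c s : R) : R :=
  (1 - c) * (chord_radius c s ^+ 2 + chord_radius c s * c) + c ^+ 2.

Definition angle_density (R : realType) (c s : R) : R :=
  2 * (1 - c) * Num.sqrt ((1 - s ^+ 2) * c ^+ 3 /
                          (chord_radius c s ^+ 2 * chord_cofactor c s)).

(** The angle swept by the strong solution curve with turning radius c while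
    its radius goes from 1 to c, see [half_apertureE].  Unlike that integral, it
    also has a meaning at c = 1, where no D exists. *)
Definition half_aperture (R : realType) (c : R) : R :=
  \int[lebesgue_measure]_(s in `[0, 1]) angle_density c s.

Lemma chord_radius_ge (R : realType) (m c s : R) :
  m <= c -> m <= 1 -> 0 <= s <= 1 -> m <= chord_radius c s.
Proof.
move=> mc m1 /andP[s0 s1]; rewrite -subr_ge0 /chord_radius.
have -> : c + (1 - c) * s ^+ 2 - m = (c - m) * (1 - s ^+ 2) + (1 - m) * s ^+ 2
  by ring.
by rewrite addr_ge0// mulr_ge0 ?subr_ge0 ?sqr_ge0// exprn_ile1.
Qed.

(** The bound 5 / 4 is one of many values above 1: the term in 1 - c is
    nonnegative for c <= 1, and for larger c it is at least - 2 (c - 1) c^2, so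
    that it uses up at most half of c^2 as long as c - 1 <= 1 / 4.  Allowing
    c > 1 puts c = 1 in the interior of the parameter range. *)
Lemma chord_cofactor_ge (R : realType) (c s : R) :
  0 < c < 5 / 4 -> 0 <= s <= 1 -> c ^+ 2 / 2 <= chord_cofactor c s.
Proof.
move=> /andP[c0 c54] s01; rewrite /chord_cofactor.
have [c1|c1] := leP c 1.
  have uc := chord_radius_ge (lexx c) c1 s01.
  move: (chord_radius c s) uc => u uc.
  have : 0 <= (1 - c) * (u ^+ 2 + u * c).
    by rewrite mulr_ge0 ?subr_ge0// addr_ge0 ?sqr_ge0// mulr_ge0; lra.
  have := sqr_ge0 c; lra.
have u1 := chord_radius_ge (ltW c1) (lexx 1) s01.
have uc : chord_radius c s <= c.
  by rewrite /chord_radius gerDl mulr_le0_ge0 ?sqr_ge0// subr_le0 ltW.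
move: (chord_radius c s) u1 uc => u u1 uc.
have u2c : u ^+ 2 <= c ^+ 2 by rewrite lerXn2r ?nnegrE ?(ltW c0)//; lra.
have ucc : u * c <= c ^+ 2 by rewrite expr2 ler_wpM2r ?(ltW c0).
have c14 : c - 1 <= 1 / 4 by lra.
have := ler_wpM2r (addr_ge0 (sqr_ge0 u) (mulr_ge0 (le_trans ler01 u1) (ltW c0))) c14.
lra.
Qed.

Lemma angle_density_denominator_gt0 (R : realType) (c s : R) :
  0 < c < 5 / 4 -> 0 <= s <= 1 ->
  0 < chord_radius c s ^+ 2 * chord_cofactor c s.
Proof.
move=> c054 s01; have /andP[c0 _] := c054.
have m0 : 0 < Num.min c 1 by rewrite lt_min c0 ltr01.
rewrite mulr_gt0//.
  rewrite exprn_gt0// (lt_le_trans m0)// chord_radius_ge ?ge_min ?lexx//.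
  by rewrite orbT.
by apply: lt_le_trans (chord_cofactor_ge c054 s01); rewrite divr_gt0 ?exprn_gt0.
Qed.

(** Stated along an arbitrary filter so as to yield the continuity both in c
    and in s. *)
Lemma cvg_angle_density (R : realType) (T : Type) (F : set_system T)
    (FF : Filter F) (x y : T -> R) (c s : R) :
  0 < c < 5 / 4 -> 0 <= s <= 1 ->
  x z @[z --> F] --> c -> y z @[z --> F] --> s ->
  angle_density (x z) (y z) @[z --> F] --> angle_density c s.
Proof.
move=> c054 s01 xc ys.
have cX n (h : T -> R) (l : R) : h z @[z --> F] --> l -> (h z) ^+ n @[z --> F] --> l ^+ n.
  by move=> hl; exact: (cvg_comp _ _ hl (@exprn_continuous R n l)).
have c1 : (cst 1 : T -> R) z @[z --> F] --> (1 : R) by exact: cvg_cst.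
have x1 : 1 - x z @[z --> F] --> 1 - c by exact: cvgB.
have u : chord_radius (x z) (y z) @[z --> F] --> chord_radius c s.
  by apply: cvgD => //; apply: cvgM => //; exact: cX.
apply: cvgM; first by apply: cvgM => //; exact: cvg_cst.
apply: (continuous_cvg FF (h := @Num.sqrt R)); first exact: sqrt_continuous.
apply: cvgM; first by apply: cvgM; [apply: cvgB => //|]; exact: cX.
apply: cvgV; first by rewrite gt_eqF// angle_density_denominator_gt0.
apply: cvgM; first exact: cX.
apply: cvgD; last exact: cX.
by apply: cvgM => //; apply: cvgD; [exact: cX|exact: cvgM].
Qed.

Lemma angle_density_continuous (R : realType) (c : R) : 0 < c < 5 / 4 ->
  {in `[0, 1], continuous (angle_density c)}.
Proof.
move=> c054 s; rewrite in_itv/= => s01.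
by apply: (cvg_angle_density (F := nbhs s)) => //; exact: cvg_cst.
Qed.

Lemma angle_density_integrable (R : realType) (c : R) : 0 < c < 5 / 4 ->
  lebesgue_measure.-integrable `[0, 1] (EFin \o angle_density c).
Proof.
move=> c054; apply: continuous_compact_integrable; first exact: segment_compact.
apply: continuous_in_subspaceT => s; rewrite inE/=.
exact: angle_density_continuous.
Qed.

(** The dominating constant for the parameters above m: the radius is at least
    m and the cofactor at least m^2 / 2, while c^3 < 2. *)
Lemma angle_density_bound (R : realType) (m c s : R) :
  0 < m <= 1 -> m < c < 5 / 4 -> 0 <= s <= 1 ->
  `|angle_density c s| <= 2 * Num.sqrt (4 / m ^+ 4).
Proof.
move=> /andP[m0 m1] /andP[mc c54] s01; have /andP[s0 s1] := s01.
have c0 : 0 < c by exact: lt_trans mc.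
have c054 : 0 < c < 5 / 4 by rewrite c0.
have mu := chord_radius_ge (ltW mc) m1 s01.
have mQ : m ^+ 2 / 2 <= chord_cofactor c s.
  apply: le_trans (chord_cofactor_ge c054 s01).
  by rewrite ler_pM2r// lerXn2r ?nnegrE ?ltW.
rewrite normrM (ger0_norm (sqrtr_ge0 _)) ler_pM//.
  by rewrite normrM ger0_norm// ler_piMr// ler_norml; lra.
apply: ler_wsqrtr; rewrite ler_pdivrMr ?angle_density_denominator_gt0//.
have num : (1 - s ^+ 2) * c ^+ 3 <= 2.
  have s2 : 0 <= 1 - s ^+ 2 <= 1 by rewrite subr_ge0 exprn_ile1// gerBl sqr_ge0.
  have c3 : 0 <= c ^+ 3 <= 2.
    rewrite exprn_ge0 ?(ltW c0)//= (@le_trans _ _ ((5 / 4) ^+ 3))//; last lra.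
    by rewrite lerXn2r ?nnegrE ?ltW.
  by nra.
apply: (le_trans num).
have den : m ^+ 2 * (m ^+ 2 / 2) <= chord_radius c s ^+ 2 * chord_cofactor c s.
  by rewrite ler_pM ?divr_ge0 ?sqr_ge0// lerXn2r ?nnegrE ?(ltW m0)// (le_trans (ltW m0)).
apply: le_trans (ler_wpM2l _ den); last by rewrite divr_ge0// exprn_ge0// ltW.
rewrite le_eqVlt; apply/orP; left; apply/eqP; field.
by rewrite gt_eqF.
Qed.

(** Dominated convergence on an open interval around c that stays away from 0,
    where the integrands are uniformly bounded. *)
Lemma half_aperture_continuous (R : realType) :
  {in `]0, 5 / 4[, continuous (@half_aperture R)}.
Proof.
move=> c; rewrite in_itv/= => /andP[c0 c54].
pose m := Num.min (c / 2) 1.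
have m0 : 0 < m by rewrite lt_min ltr01 divr_gt0.
have m1 : m <= 1 by rewrite ge_min lexx orbT.
have mc : m < c by rewrite gt_min; apply/orP; left; lra.
have m01 : 0 < m <= 1 by rewrite m0.
have pos x : `]m, (5 / 4)[%classic x -> 0 < x < 5 / 4.
  by rewrite /= in_itv/= => /andP[/(lt_trans m0)->].
have bnd_int : lebesgue_measure.-integrable `[0%R, 1%R]
    (EFin \o cst (2 * Num.sqrt (4 / m ^+ 4))).
  apply: continuous_compact_integrable; first exact: segment_compact.
  by apply: continuous_subspaceT => x; exact: cvg_cst.
apply: (continuity_under_integral (u := m) (v := 5 / 4) _ _ _ bnd_int) => //.
- by move=> x /pos; exact: angle_density_integrable.
- apply: aeW => s s01 x; rewrite inE => /pos x054.
  by apply: (cvg_angle_density (F := nbhs x)) => //; exact: cvg_cst.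
- move=> x; rewrite /= in_itv/= => xm; apply: aeW => s; rewrite /= in_itv/= => s01.
  exact: angle_density_bound.
- by rewrite inE/= in_itv/= mc.
Qed.

Lemma half_aperture1 (R : realType) : half_aperture (1 : R) = 0.
Proof.
transitivity (\int[@lebesgue_measure R]_(s in `[0, 1]) (0 : R)).
  by apply: eq_Rintegral => s _; rewrite /angle_density subrr mulr0 mul0r.
by rewrite Rintegral_cst// mul0r.
Qed.

(** The reason for the substitution: the denominator under the root in
    [fS D] is s^2 times that of [angle_density], and the factor s of du cancels
    it.  At s = 0 the identity fails, the left-hand side being 0. *)
Lemma fS_chord_radius (R : realType) (D c s : R) : 0 < c < 1 -> 2 * D * (1 - c) = c ^+ 3 ->
  0 < s <= 1 ->
  fS D (chord_radius c s) * (2 * (1 - c) * s) = angle_density c s.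
Proof.
move=> /andP[c0 c1] hD /andP[s0 s1].
have c54 : 0 < c < 5 / 4 by rewrite c0; lra.
have s01 : 0 <= s <= 1 by rewrite s1 ltW.
have den := angle_density_denominator_gt0 c54 s01.
set N := (1 - s ^+ 2) * c ^+ 3.
set E := chord_radius c s ^+ 2 * chord_cofactor c s in den.
have -> : fS D (chord_radius c s) = Num.sqrt (N / (s ^+ 2 * E)).
  rewrite /fS; congr (Num.sqrt (_ / _)).
    by rewrite /N -hD /chord_radius; ring.
  have -> : chord_radius c s ^+ 5 - 2 * chord_radius c s ^+ 2 * D * (1 - chord_radius c s)
     = chord_radius c s ^+ 2 * (chord_radius c s ^+ 3 - (2 * D * (1 - c)) * (1 - s ^+ 2)).
    by rewrite /chord_radius; ring.
  rewrite hD /E mulrCA; congr (_ * _).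
  by rewrite /chord_cofactor /chord_radius; ring.
have sE : N / (s ^+ 2 * E) = (s^-1) ^+ 2 * (N / E).
  by field; rewrite !gt_eqF.
rewrite sE sqrtrM ?sqr_ge0// sqrtr_sqr ger0_norm ?invr_ge0 ?(ltW s0)//.
rewrite /angle_density -/N -/E; field.
by rewrite gt_eqF.
Qed.

Lemma fS_continuous (R : realType) (D : R) : 0 < D ->
  {in `]r_c D, 1], continuous (fS D)}.
Proof.
move=> D0 u; rewrite in_itv/= => /andP[cu u1].
have [/andP[c0 c1] hc] := r_cP D0.
have u0 : 0 < u := lt_trans c0 cu.
have cX n : v ^+ n @[v --> u] --> u ^+ n by exact: exprn_continuous.
have cC (k : R) : (cst k : R -> R) v @[v --> u] --> k by exact: cvg_cst.
have cid : v @[v --> u] --> u by exact: cvg_id.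
have c1u : 1 - v @[v --> u] --> 1 - u by apply: cvgB; [exact: cC|exact: cid].
apply: (continuous_cvg _ (h := @Num.sqrt R)); first exact: sqrt_continuous.
apply: cvgM; first by apply: cvgM; [apply: cvgM|]; first [exact: cC | exact: c1u].
apply: cvgV; last first.
  apply: cvgB; first exact: cX.
  apply: cvgM; last exact: c1u.
  by apply: cvgM; [apply: cvgM|]; first [exact: cC | exact: cX].
rewrite gt_eqF//.
have -> : u ^+ 5 - 2 * u ^+ 2 * D * (1 - u) =
  u ^+ 2 * ((u - r_c D) * (u ^+ 2 + u * r_c D + r_c D ^+ 2 + 2 * D)
            + (r_c D ^+ 3 + 2 * D * r_c D - 2 * D)) by ring.
rewrite hc addr0 !mulr_gt0 ?exprn_gt0 ?subr_gt0// !addr_gt0 ?exprn_gt0 ?mulr_gt0//.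
Qed.

Lemma half_apertureE (R : realType) (D : R) : 0 < D ->
  \int[lebesgue_measure]_(u in `[r_c D, 1]) fS D u = half_aperture (r_c D).
Proof.
move=> D0; have [c01 hc] := r_cP D0.
have hD : 2 * D * (1 - r_c D) = r_c D ^+ 3 by lra.
have cfS := fS_continuous D0.
move: (r_c D) c01 {hc} hD cfS => c c01 hD cfS.
have /andP[c0 c1] := c01.
have c54 : 0 < c < 5 / 4 by rewrite c0; lra.
have dF (s : R) : is_derive s 1 (chord_radius c) (2 * (1 - c) * s).
  rewrite /chord_radius; apply: is_derive_eq.
  rewrite /GRing.scale/=; ring.
have F'E : (chord_radius c)^`()%classic = (fun s => 2 * (1 - c) * s).
  by apply/funext => s; rewrite derive1E derive_val.
have F0 : chord_radius c 0 = c by rewrite /chord_radius expr0n mulr0 addr0.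
have F1 : chord_radius c 1 = 1 by rewrite /chord_radius expr1n mulr1 addrC subrK.
have cad : {in `]0, 1], continuous (angle_density c)}.
  by move=> s s01; apply: angle_density_continuous => //; exact: subset_itv_oc_cc.
rewrite /half_aperture /Rintegral; congr fine.
(* The endpoint c, where fS D takes the junk value 0, carries no mass. *)
rewrite -[LHS]integral_itv_obnd_cbnd; last first.
  by apply/measurable_EFinP; exact: continuous_oc_measurable.
rewrite -[RHS]integral_itv_obnd_cbnd; last first.
  by apply/measurable_EFinP; exact: continuous_oc_measurable.
have := integration_by_substitution_left_singular
  (F := chord_radius c) (G := fS D) ltr01.
rewrite F0 F1 F'E => ->//.
- by apply: eq_integral => s; rewrite inE/= in_itv/= => s01; rewrite fS_chord_radius.
- by move=> s _; apply: cvgM; [exact: cvg_cst|exact: cvg_id].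
- by move=> s; rewrite in_itv/= => /andP[s0 _]; rewrite !mulr_gt0// subr_gt0.
- by move=> u _; exact: sqrtr_ge0.
Qed.

(** * The strong solution curves *)

Lemma rS_half (R : realType) (D : R) : rS D 2^-1 = r_c D.
Proof. by rewrite /rS lexx; field. Qed.

Lemma rS1 (R : realType) (D : R) : rS D 1 = 1.
Proof. by rewrite /rS ifF; [ring|apply/negbTE; rewrite -ltNge; lra]. Qed.

Lemma thetaS_half (R : realType) (D : R) : 0 < D ->
  thetaS D 2^-1 = half_aperture (r_c D).
Proof. by move=> D0; rewrite /thetaS lexx /thetaS_in rS_half half_apertureE. Qed.

Lemma thetaS1 (R : realType) (D : R) : 0 < D ->
  thetaS D 1 = 2 * half_aperture (r_c D).
Proof.
move=> D0; rewrite /thetaS ifF; last by apply/negbTE; rewrite -ltNge; lra.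
by rewrite /thetaS_in rS_half rS1 half_apertureE//; ring.
Qed.

Lemma rS_ge_r_c (R : realType) (D s : R) : 0 < D -> 0 <= s <= 1 ->
  r_c D <= rS D s.
Proof.
move=> D0 /andP[s0 s1]; have [/andP[_ c1] _] := r_cP D0.
by rewrite /rS; case: ifPn => [s2|]; [|rewrite -ltNge => s2]; nra.
Qed.

Lemma enorm_polar (R : realType) (r theta : R -> R) (s : R) :
  0 <= r s -> enorm (polar r theta s) = r s.
Proof.
move=> r0; rewrite /enorm /polar/= !exprMn -mulrDr cos2Dsin2 mulr1.
by rewrite sqrtr_sqr ger0_norm.
Qed.

(** The turning radius increases with D, because 2 D = c^3 / (1 - c). *)
Lemma Deps_le (R : realType) (eps D : R) : 0 < eps < 1 -> 0 < D ->
  eps <= r_c D -> Deps eps <= D.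
Proof.
move=> eps01 D0 epsc; have [E0 Ec] := DepsP eps01.
have [/andP[c0 c1] hc] := r_cP D0; have [_] := r_cP E0; rewrite Ec => he.
have /andP[e0 e1] := eps01.
have cube : eps ^+ 3 <= r_c D ^+ 3 by rewrite lerXn2r ?nnegrE ?(ltW e0) ?(ltW c0).
rewrite -(ler_pM2r (x := 1 - eps)) ?subr_gt0//.
have : D * (1 - r_c D) <= D * (1 - eps) by rewrite ler_pM2l//; lra.
lra.
Qed.

(** The root found on [eps, 1] is not 1, since the swept angle vanishes there
    while [phi] is positive. *)
Lemma exists_half_aperture (R : realType) (eps phi : R) :
  0 < eps < 1 -> 0 < phi -> phi < half_aperture eps ->
  exists c : R, eps <= c < 1 /\ half_aperture c = phi.
Proof.
move=> /andP[e0 e1] phi0 phie.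
have [c] : exists2 c, c \in `[eps, 1] & half_aperture c = phi.
  apply: IVT; first exact: ltW.
    apply: continuous_in_subspaceT => c; rewrite inE/= in_itv/= => /andP[ec c1].
    by apply: half_aperture_continuous; rewrite in_itv/= (lt_le_trans e0 ec); lra.
  by rewrite half_aperture1 ge_min le_max (ltW phi0) (ltW phie) orbT.
rewrite in_itv/= => /andP[ec]; rewrite le_eqVlt => /predU1P[->|c1] hc; last first.
  by exists c; rewrite ec.
by move: phi0; rewrite -hc half_aperture1 ltxx.
Qed.

Unset Implicit Arguments.

Theorem proposition6 (R : realType)
  (strong_min : forall D : R, 0 < D ->
     minimizes (polar (rS D) (thetaS D))
               (A0 (polar (rS D) (thetaS D) 1)) /\
     minimizes (polar (rS D) (fun s => - thetaS D s))
               (A0 (polar (rS D) (fun s => - thetaS D s) 1)))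
  (eps theta_f : R)
  (heps : 0 < eps < 1)
  (htheta_f : 0 < theta_f <= pi)
  (hlt : theta_f / 2 < theta_c eps) :
  exists D : R,
    [/\ 0 < Deps eps,
        Deps eps <= D,
        Aeps eps (cos theta_f, sin theta_f) (polar (rS D) (thetaS D)) &
        minimizes (polar (rS D) (thetaS D))
                  (Aeps eps (cos theta_f, sin theta_f))].
Proof.
have [eps0 eps1] := andP heps.
have [Deps0 r_c_Deps] := DepsP heps.
have phi0 : 0 < theta_f / 2 by case/andP: htheta_f => t0 _; rewrite divr_gt0.
move: hlt; rewrite /theta_c thetaS_half// r_c_Deps => hlt'.
have [c [/andP[ec c1] hc]] := exists_half_aperture heps phi0 hlt'.
have c0 : 0 < c := lt_le_trans eps0 ec.
have c01 : 0 < c < 1 by rewrite c0.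
(* Deps inverts r_c, hence provides the curve with turning radius c. *)
have [D0 r_c_D] := DepsP c01.
set D := Deps c in D0 r_c_D.
have endpoint : polar (rS D) (thetaS D) 1 = (cos theta_f, sin theta_f).
  rewrite /polar rS1 !mul1r thetaS1// r_c_D hc mulrC divfK//.
have [[A0D minD] _] := strong_min D D0.
rewrite endpoint in A0D minD.
have AepsD : Aeps eps (cos theta_f, sin theta_f) (polar (rS D) (thetaS D)).
  split=> // s s01; have := rS_ge_r_c D0 s01; rewrite r_c_D => cr.
  by rewrite enorm_polar ?(le_trans ec)// (le_trans (ltW c0)).
exists D; split; [exact: Deps0| |exact: AepsD|].
  by apply: (Deps_le heps D0); rewrite r_c_D.
by split; [exact: AepsD | move=> beta [A0beta _]; exact: minD].
Qed.
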